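(* Let $X$ and $Y$ be Banach spaces, $C\in \mathcal{L}(X,Y)$, $(P_\lambda)_{\lambda>0}$ a family in $\mathcal{L}(X)$, and $(S(t))_{t\geq 0}$ a bounded $C_0$-semigroup on $X$. Let $T>0$, $g\colon (0,\infty) \to (0,\infty)$ measurable and $C_1\geq 0$, $C_2\geq 1$ such that \[ \forall \lambda>0,\ x\in X: \quad \lVert P_\lambda x \rVert_{X} \le C_1 e^{\lambda} \lVert C P_\lambda x \rVert_{Y} \] and \[ \forall \lambda>0,\ t\in (0,T],\ x\in X: \quad \lVert (\mathrm{Id}-P_\lambda) S(t) x \rVert_{X} \le C_2 e^{-g(\lambda)t} \lVert x \rVert_{X}. \] Let $\varphi\colon (0,\infty)\to [0,\infty)$ be a Bernstein function, $(S^\varphi(t))_{t\geq 0}$ the subordinated semigroup to $(S(t))_{t\geq 0}$ with respect to $\varphi$, and assume that $\lambda \mapsto \lambda/\varphi(g(\lambda))$ is (well defined and) monotonically decreasing on $(0,\infty)$ and that $1/(\varphi\circ g)$ is integrable at $\infty$. Then there exists $C_{\mathrm{obs}}\geq 0$ such that \[ \forall x\in X: \quad \lVert S^\varphi(T)x\rVert_X\leq C_{\mathrm{obs}} \int_0^T \lVert C S^\varphi(\tau) x \rVert_{Y} \, d\tau. \]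
   Context: $\mathcal{L}(X,Y)$ denotes the bounded linear operators from $X$ to $Y$, and $\mathcal{L}(X)=\mathcal{L}(X,X)$. A function is integrable at $\infty$ if it is integrable on $(R,\infty)$ for some $R>0$. A function $\varphi\colon(0,\infty)\to[0,\infty)$ is a Bernstein function if $\varphi\in C^\infty(0,\infty)$ and $(-1)^{k-1}\varphi^{(k)}\ge 0$ for all $k\in\{1,2,\dots\}$. For every Bernstein function $\varphi$ there is a unique family $(\mu_t)_{t\ge0}$ of Radon measures on $[0,\infty)$ which is a vaguely continuous convolution semigroup of sub-probability measures, i.e. $\mu_t([0,\infty))\le 1$ for all $t\ge 0$, $\mu_0=\delta_0$, $\mu_t*\mu_s=\mu_{t+s}$ for all $s,t\ge0$, and $\lim_{t\to s}\int f\,d\mu_t=\int f\,d\mu_s$ for all $f\in C_c[0,\infty)$ and $s\geq 0$, such that the Laplace transforms satisfy $\int_{[0,\infty)}e^{-\lambda s}\,\mu_t(ds)=e^{-t\varphi(\lambda)}$ for all $t\ge0$, $\lambda>0$. For a bounded $C_0$-semigroup $(S(t))_{t\ge 0}$ on $X$, the subordinated semigroup to $(S(t))_{t\ge0}$ with respect to $\varphi$ is $(S^\varphi(t))_{t\ge0}$ with $S^\varphi(t)x:=\int_{[0,\infty)}S(s)x\,\mu_t(ds)$ for $x\in X$; it is again a bounded $C_0$-semigroup on $X$. *)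

(* Defs.v *)
From HB Require Import structures.
From mathcomp Require Import all_boot all_order all_algebra.
From mathcomp Require Import all_classical all_reals all_analysis.
Import Order.TTheory GRing.Theory Num.Theory.
Import numFieldNormedType.Exports.

Set Implicit Arguments.
Unset Strict Implicit.
Unset Printing Implicit Defensive.

Local Open Scope classical_set_scope.
Local Open Scope ring_scope.

(* Banach spaces are modelled as [completeNormedModType R] with [R : realType].
   A complex Banach space is covered by restriction of scalars: it is a real
   Banach space with the same norm, its bounded operators are R-linear, and
   nothing below refers to scalars other than through real-valued norms. *)

Definition bounded_operator (R : realType) (X Y : normedModType R)
    (A : X -> Y) : Prop :=
  exists M : R, forall x, `|A x| <= M * `|x|.

(* Families indexed by [0, oo) or (0, oo) are functions on all of R whose
   values outside of that range are irrelevant. *)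

Record bounded_C0_semigroup (R : realType) (X : normedModType R)
    (S : R -> {linear X -> X}) : Prop := {
  C0_id : forall x, S 0 x = x;
  C0_add : forall (s t : R) x, 0 <= s -> 0 <= t -> S (s + t) x = S s (S t x);
  C0_strong_continuity : forall x, S t x @[t --> 0^'+] --> x;
  C0_bounded : exists M : R, forall (t : R) x, 0 <= t -> `|S t x| <= M * `|x|
}.

Record Bernstein_function (R : realType) (phi : R -> R) : Prop := {
  Bernstein_ge0 : forall x : R, 0 < x -> 0 <= phi x;
  Bernstein_smooth : forall k (x : R), 0 < x -> derivable (phi^`(k))%classic x 1;
  Bernstein_sign :
    forall k (x : R), (1 <= k)%N -> 0 < x ->
      0 <= (- 1) ^+ k.-1 * (phi^`(k))%classic x
}.

(* A finite Borel measure on [0, oo) is encoded as a Borel measure on R that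
   vanishes on (-oo, 0); finite Borel measures are automatically Radon here. *)
Record convolution_semigroup (R : realType)
    (mu : R -> subprobability (measurableTypeR R) R) : Prop := {
  conv_support : forall t : R, 0 <= t -> mu t `]-oo, 0%R[%classic = 0%E;
  conv_zero : forall A, measurable A -> mu 0 A = \d_(0 : R) A;
  conv_add : forall (s t : R) A, 0 <= s -> 0 <= t -> measurable A ->
    pushforward (mu t \x mu s)%E (fun p : R * R => p.1 + p.2) A = mu (t + s) A;
  conv_vague : forall (f : R -> R) (s : R), 0 <= s ->
    {within `[0, +oo[, continuous f} ->
    (exists K : set R,
      [/\ compact K, K `<=` `[0, +oo[ & forall x : R, 0 <= x -> ~ K x -> f x = 0]) ->
    (\int[mu t]_(x in `[0, +oo[) f x)
        @[t --> within `[0, +oo[ (nbhs s)]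
      --> \int[mu s]_(x in `[0, +oo[) f x
}.

Definition subordinator (R : realType) (phi : R -> R)
    (mu : R -> subprobability (measurableTypeR R) R) : Prop :=
  convolution_semigroup mu /\
  forall t l : R, 0 <= t -> 0 < l ->
    (\int[mu t]_(s in `[0%R, +oo[) (expR (- l * s))%:E
      = (expR (- t * phi l))%:E)%E.

(* The simple function equal to the sum of the vectors [simple_vec i] times the
   indicator functions of the (possibly overlapping) sets [simple_set i]. *)
Record simple_function d (T : measurableType d) (R : realType)
    (X : normedModType R) := SimpleFunction {
  simple_size : nat;
  simple_set : 'I_simple_size -> set T;
  simple_vec : 'I_simple_size -> X;
  simple_measurable : forall i, measurable (simple_set i)
}.

Definition simple_eval d (T : measurableType d) (R : realType)
    (X : normedModType R) (h : simple_function T X) (x : T) : X :=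
  \sum_(i < simple_size h) (\1_(simple_set i) x : R) *: simple_vec i.

Definition simple_integral d (T : measurableType d) (R : realType)
    (X : normedModType R) (mu : {measure set T -> \bar R}) (D : set T)
    (h : simple_function T X) : X :=
  \sum_(i < simple_size h) fine (mu (simple_set i `&` D)) *: simple_vec i.

(* [f] is Bochner integrable over [D] with respect to [mu], with integral [y].
   The pointwise convergence on [D] is the strong measurability of [f]. *)
Definition is_Bochner_integral d (T : measurableType d) (R : realType)
    (X : normedModType R) (mu : {measure set T -> \bar R}) (D : set T)
    (f : T -> X) (y : X) : Prop :=
  exists h : nat -> simple_function T X,
    [/\ forall n (i : 'I_(simple_size (h n))),
          (mu (simple_set i `&` D) < +oo)%E,
        forall x, D x -> simple_eval (h n) x @[n --> \oo] --> f x,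
        (\int[mu]_(x in D) (`|f x - simple_eval (h n) x|%R)%:E)%E
          @[n --> \oo] --> (0%R)%:E
      & simple_integral mu D (h n) @[n --> \oo] --> y].

(* [mu] is uniquely determined by [phi], and then [Sphi t x] by [S]. *)
Definition subordinated_semigroup (R : realType) (X : normedModType R)
    (phi : R -> R) (S : R -> X -> X) (Sphi : R -> X -> X) : Prop :=
  exists mu : R -> subprobability (measurableTypeR R) R,
    subordinator phi mu /\
    forall (t : R) x, 0 <= t ->
      is_Bochner_integral (mu t) `[0, +oo[ (fun s => S s x) (Sphi t x).

Definition integrable_at_infinity (R : realType) (f : R -> R) : Prop :=
  exists2 r : R, 0 < r & lebesgue_measure.-integrable `]r, +oo[ (EFin \o f).

(* Main.v *)
(* A norming functional reduces Bochner integrals to scalar ones, which gives the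
   semigroup law and the bounds for [Sphi] from Fubini's theorem. As [phi] grows at
   most affinely, [expR (- g * T)] is at most a constant times [expR (- t * phi g)]
   for [t <= T'] with [T'] small, so that [Sphi] satisfies a dissipation estimate with
   rate [phi (g l)] on [[0, T']]. Combined with the uncertainty principle, for
   [s < t <= T'],
     [|Sphi t x| <= K e^l (|C (Sphi t x)| + e^(- phi (g l) (t - s)) |Sphi s x|)].
   This is iterated at [l_k = l_0 2^k] over consecutive intervals [[t_(k+1), t_k]],
   going backwards from [t_0 = T'], of lengths
   [6 l_k / phi (g l_k) + (T' / 4) 2^(-k)]: by monotonicity and integrability of
   [1 / (phi \o g)] these sum up to at most [T'] once [l_0] is large, and the
   resulting inequalities telescope. *)
Require Import Defs.
From HB Require Import structures.
From mathcomp Require Import all_boot all_order all_algebra.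
From mathcomp Require Import all_classical all_reals all_analysis.
From mathcomp Require Import measurable_realfun ring lra.
Import Order.TTheory GRing.Theory Num.Theory.
Import numFieldNormedType.Exports.
Set Implicit Arguments.
Unset Strict Implicit.
Unset Printing Implicit Defensive.
Local Open Scope classical_set_scope.
Local Open Scope ring_scope.

(** * The Hahn-Banach theorem *)

Section hahn_banach.
Context {R : realType} {X : normedModType R}.

(* Functionals on subspaces are represented by their graphs; the domination
   [r <= `|x|] makes a graph closed under linear combinations functional. *)
Definition dominated_graph (G : set (X * R)) : Prop :=
  (forall a p q, G p -> G q -> G (a *: p.1 + q.1, a * p.2 + q.2)) /\
  (forall p, G p -> p.2 <= `|p.1|).

Definition extend_graph (G : set (X * R)) (z : X) (c : R) : set (X * R) :=
  [set q | exists p a, G p /\ q = (p.1 + a *: z, p.2 + a * c)].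

Lemma dominated_graph0 G : dominated_graph G -> G !=set0 -> G (0, 0).
Proof.
move=> [lG _] [p Gp]; have := lG (-1) p p Gp Gp.
by rewrite scaleN1r mulN1r !addNr.
Qed.

Lemma dominated_graph_extend G z : dominated_graph G -> G !=set0 ->
  exists c, dominated_graph (extend_graph G z c).
Proof.
move=> dG G0; have G00 := dominated_graph0 dG G0; case: dG => lG leG.
have GZ a p : G p -> G (a *: p.1, a * p.2).
  by move=> Gp; have := lG a p (0, 0) Gp G00; rewrite /= !addr0.
pose E := [set q.2 - `|q.1 - z| | q in G].
have Eub p : G p -> ubound E (`|p.1 + z| - p.2).
  move=> Gp _ [q Gq <-]; rewrite lerBlDr addrAC lerBrDr.
  have := leG _ (lG 1 q p Gq Gp); rewrite /= scale1r mul1r => /le_trans; apply.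
  rewrite [leRHS]addrC (_ : q.1 + p.1 = (q.1 - z) + (p.1 + z)) ?ler_normD//.
  by rewrite addrACA addNr addr0.
have supE : has_sup E.
  by split; [exists (0 - `|0 - z|); exists (0, 0)|exists (`|0 + z| - 0); exact: (Eub (0, 0))].
have cub p : G p -> sup E <= `|p.1 + z| - p.2.
  by move=> Gp; apply: ge_sup; [exact: supE.1|exact: Eub].
have clb p : G p -> p.2 - `|p.1 - z| <= sup E.
  by move=> Gp; apply: sup_upper_bound => //; exists p.
exists (sup E); split.
  move=> a _ _ [p [b [Gp ->]]] [q [d [Gq ->]]].
  exists (a *: p.1 + q.1, a * p.2 + q.2), (a * b + d); split; first exact: lG.
  congr (_, _) => /=; last by ring.
  by rewrite scalerDr scalerDl scalerA addrACA.
move=> _ [p [a [Gp ->]]] /=.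
have [a0|a0|->] := ltgtP a 0; last by rewrite scale0r mul0r !addr0; exact: leG.
- have Na : 0 < - a by rewrite oppr_gt0.
  have := clb _ (GZ (- a)^-1 p Gp); rewrite /= => h.
  have := ler_wpM2l (ltW Na) h.
  rewrite mulrBr mulrA divff ?gt_eqF// mul1r.
  have -> (u : X) : - a * `|u| = `|- a *: u| by rewrite normrZ gtr0_norm.
  rewrite scalerBr scalerA divff ?gt_eqF// scale1r scaleNr opprK.
  by rewrite mulNr lerBlDr addrC -lerBlDr opprK.
- have := cub _ (GZ a^-1 p Gp); rewrite /= => h.
  have := ler_wpM2l (ltW a0) h.
  rewrite mulrBr mulrA divff ?gt_eqF// mul1r.
  have -> (u : X) : a * `|u| = `|a *: u| by rewrite normrZ gtr0_norm.
  by rewrite scalerDr scalerA divff ?gt_eqF// scale1r lerBrDr addrC.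
Qed.

Lemma norming_functional (v : X) :
  exists f : {linear X -> R^o}, f v = `|v| /\ forall x, `|f x| <= `|x|.
Proof.
pose P G := dominated_graph G /\ (G !=set0 -> G (v, `|v|)).
have Pline : P [set (a *: v, a * `|v|) | a in setT].
  split; last by exists 1; rewrite // scale1r mul1r.
  split => [a _ _ [b _ <-] [c _ <-]|_ [a _ <-]] /=.
    by exists (a * b + c) => //; rewrite scalerDl scalerA mulrDl mulrA.
  by rewrite normrZ ler_wpM2r ?ler_norm.
have [F sFP totF|G [[dG GP] maxG]] := @Zorn_bigcup _ P.
  split; last first.
    by move=> [p [A FA Ap]]; exists A => //; apply: (sFP _ FA).2; exists p.
  split; last by move=> p [A FA Ap]; exact: (sFP _ FA).1.2.
  move=> a p q [A FA Ap] [B FB Bq].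
  have [AB|BA] := totF A B FA FB.
    by exists B => //; apply: (sFP _ FB).1.1 => //; exact: AB.
  by exists A => //; apply: (sFP _ FA).1.1 => //; exact: BA.
have G0 : G !=set0.
  apply/set0P/eqP => G0; apply: maxG Pline; rewrite G0.
  rewrite properEneq; split => //; rewrite eq_sym; apply/set0P.
  by exists (0, 0); exists 0 => //; rewrite scale0r mul0r.
have G00 := dominated_graph0 dG G0; have Gv := GP G0.
have tot x : exists r, G (x, r).
  apply: contrapT => nGx.
  have [c dE] := dominated_graph_extend x dG G0.
  have sGE : G `<=` extend_graph G x c.
    by move=> p Gp; exists p, 0; rewrite scale0r mul0r !addr0 -surjective_pairing.
  apply: (maxG (extend_graph G x c)); last by split=> // _; exact: sGE.
  rewrite properEneq; split => //; apply/eqP => GE; apply: nGx; exists c.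
  by rewrite GE; exists (0, 0), 1; rewrite scale1r mul1r !add0r.
have [f Gf] := choice tot; case: dG => lG leG.
have uniG x r : G (x, r) -> r = f x.
  move=> Gr; apply/eqP; rewrite eq_le; apply/andP; split; rewrite -subr_le0.
    have := leG _ (lG (-1) _ _ (Gf x) Gr).
    by rewrite /= scaleN1r addNr normr0 mulN1r addrC.
  have := leG _ (lG (-1) _ _ Gr (Gf x)).
  by rewrite /= scaleN1r addNr normr0 mulN1r addrC.
have flin : linear (f : X -> R^o).
  by move=> a x y; apply/esym/uniG; exact: (lG a _ _ (Gf x) (Gf y)).
pose g : {linear X -> R^o} :=
  HB.pack (f : X -> R^o) (GRing.isLinear.Build _ _ _ _ (f : X -> R^o) flin).
exists g; split; first by apply/esym/uniG.
have leg y : g y <= `|y| by exact: leG _ (Gf y).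
by move=> x; rewrite ler_norml leg andbT lerNl -linearN (le_trans (leg _)) ?normrN.
Qed.

End hahn_banach.

(** * Bochner integrals and functionals *)

(* The integral of a nonnegative function is a supremum over simple functions, so
   that no measurability is needed here, unlike for [ge0_le_integral]. *)
Lemma ge0_le_lower_integral d (T : measurableType d) (R : realType)
    (mu : {measure set T -> \bar R}) (D : set T) (f1 f2 : T -> \bar R) :
  (forall x, D x -> 0 <= f1 x)%E -> (forall x, D x -> f1 x <= f2 x)%E ->
  (\int[mu]_(x in D) f1 x <= \int[mu]_(x in D) f2 x)%E.
Proof.
move=> f10 f12; have f20 x : D x -> (0 <= f2 x)%E.
  by move=> Dx; apply: le_trans (f10 x Dx) (f12 x Dx).
rewrite !ge0_integralE//; apply: ereal_sup_le => _ [h hf <-]; exists h => //.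
by move=> x; apply: le_trans (hf x) _; exact: lee_restrict.
Qed.

Lemma bounded_operator_cvg (R : realType) (X Y : normedModType R)
    (A : {linear X -> Y}) : bounded_operator A -> continuous A.
Proof.
move=> [M AM]; apply/linear_bounded_continuous/linear_boundedP.
near=> k => x; apply: le_trans (AM x) _; rewrite ler_wpM2r//.
Unshelve. all: by end_near. Qed.

Section bochner_functional.
Context d (T : measurableType d) (R : realType) (X : normedModType R).
Context (mu : {measure set T -> \bar R}) (D : set T) (mD : measurable D).
Context (f : T -> X) (y : X) (fy : is_Bochner_integral mu D f y).
Context (eta : {linear X -> R^o}) (eta_bounded : bounded_operator eta).

Lemma functional_simple_eval (h : simple_function T X) x :
  eta (simple_eval h x) =
  \sum_(i < simple_size h) eta (simple_vec i) * \1_(simple_set i) x.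
Proof.
by rewrite /simple_eval linear_sum; apply: eq_bigr => i _; rewrite linearZ /= mulrC.
Qed.

Lemma measurable_functional_simple (h : simple_function T X) :
  measurable_fun D (fun x => eta (simple_eval h x) : R).
Proof.
under eq_fun do rewrite functional_simple_eval.
apply: measurable_sum => i; apply: measurable_funM => //.
exact/measurable_indic/simple_measurable.
Qed.

Lemma measurable_functional_bochner : measurable_fun D (fun x => eta (f x) : R).
Proof.
case: fy => h [_ hf _ _].
apply: (measurable_fun_cvg (fun n => measurable_functional_simple (h n))) => x Dx.
exact: (continuous_cvg _ (@bounded_operator_cvg _ _ _ eta eta_bounded _) (hf x Dx)).
Qed.

Lemma integral_functional_simple (h : simple_function T X) :
  (forall i : 'I_(simple_size h), (mu (simple_set i `&` D) < +oo)%E) ->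
  mu.-integrable D (fun x => (eta (simple_eval h x))%:E) /\
  (\int[mu]_(x in D) (eta (simple_eval h x))%:E = (eta (simple_integral mu D h))%:E)%E.
Proof.
move=> hfin.
have I1 i : mu.-integrable D (fun x => (\1_(@simple_set _ _ _ _ h i) x)%:E).
  apply/integrableP; split.
    exact/measurable_EFinP/measurable_indic/simple_measurable.
  under eq_integral do rewrite gee0_abs ?lee_fin//.
  by rewrite integral_indic //; exact: simple_measurable.
have Iv i : mu.-integrable D
    (fun x => ((eta (@simple_vec _ _ _ _ h i))%:E * (\1_(simple_set i) x)%:E)%E).
  exact: integrableZl.
have E : (fun x => (eta (simple_eval h x))%:E) = (fun x =>
    \sum_(i < simple_size h) ((eta (simple_vec i))%:E * (\1_(simple_set i) x)%:E)%E).
  by apply/funext => x; rewrite functional_simple_eval -sumEFin; apply: eq_bigr.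
rewrite E; split; first exact: integrable_sum.
rewrite integral_sum// /simple_integral linear_sum -sumEFin; apply: eq_bigr => i _.
rewrite integralZl// integral_indic//; last exact: simple_measurable.
by rewrite linearZ /= EFinM fineK ?ge0_fin_numE// muleC.
Qed.

Lemma functional_bochner :
  mu.-integrable D (fun x => (eta (f x))%:E) ->
  (\int[mu]_(x in D) (eta (f x))%:E = (eta y)%:E)%E.
Proof.
move=> fint; case: fy => h [hfin _ hf hy].
have [M etaM] := eta_bounded.
pose L := Num.max M 1.
have L0 : 0 < L by rewrite lt_max ltr01 orbT.
have etaL x : `|eta x| <= L * `|x|.
  by apply: le_trans (etaM x) _; rewrite ler_wpM2r// le_max lexx.
have hn n : (\int[mu]_(x in D) (eta (simple_eval (h n) x))%:E =
    (eta (simple_integral mu D (h n)))%:E)%E.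
  exact: (integral_functional_simple (hfin n)).2.
have hint n := (integral_functional_simple (hfin n)).1.
have fin := integrable_fin_num mD fint.
have dist n : (`|fine (\int[mu]_(x in D) (eta (f x))%:E) -
    eta (simple_integral mu D (h n))|%:E <=
    L%:E * \int[mu]_(x in D) (`|f x - simple_eval (h n) x|)%:E)%E.
  have -> : (`|fine (\int[mu]_(x in D) (eta (f x))%:E) - eta (simple_integral mu D (h n))|%:E
      = `|\int[mu]_(x in D) ((eta (f x))%:E - (eta (simple_eval (h n) x))%:E)|)%E.
    by rewrite integralB// hn -[in RHS](fineK fin).
  rewrite -lee_pdivrMl//.
  have mB : measurable_fun D (fun x => ((eta (f x))%:E - (eta (simple_eval (h n) x))%:E)%E).
    apply: emeasurable_funB; apply/measurable_EFinP.
      exact: measurable_functional_bochner.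
    exact: measurable_functional_simple.
  apply: le_trans (lee_wpmul2l _ (le_abse_integral mu mD mB)) _.
    by rewrite lee_fin invr_ge0 ltW.
  rewrite -ge0_integralZl//; [|exact: measurableT_comp|by rewrite lee_fin invr_ge0 ltW].
  apply: ge0_le_lower_integral => x Dx.
    by rewrite mule_ge0// lee_fin invr_ge0 ltW.
  by rewrite lee_pdivrMl// -EFinB abse_EFin -EFinM lee_fin -linearB.
have dist0 : fine (\int[mu]_(x in D) (eta (f x))%:E) -
    eta (simple_integral mu D (h n)) @[n --> \oo] --> (0 : R).
  apply/cvgrPdist_le => e e0.
  have /fine_cvgP[fin_near /cvgrPdist_le/(_ _ (divr_gt0 e0 L0))] := hf.
  apply: filterS2 fin_near => n fn.
  rewrite /= sub0r normrN sub0r normrN => ne.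
  rewrite -lee_fin; apply: le_trans (dist n) _.
  rewrite -(fineK fn) -EFinM lee_fin mulrC -ler_pdivlMr//.
  by apply: le_trans ne; exact: ler_norm.
have etahy : eta (simple_integral mu D (h n)) @[n --> \oo] --> eta y.
  exact: (continuous_cvg _ (@bounded_operator_cvg _ _ _ eta eta_bounded _) hy).
rewrite -(fineK fin); congr EFin.
set c := fine _ in dist0 *.
have cc : (fun=> c : R) @ \oo --> eta y.
  rewrite -[eta y]add0r; apply: cvg_trans (cvgD dist0 etahy).
  by apply: near_eq_cvg; near=> n; rewrite /= subrK.
exact: (cvg_unique _ (cvg_cst c) cc).
Unshelve. all: by end_near. Qed.

End bochner_functional.

(** * Convolution semigroups on the half-line *)

Section half_line_measure.
Context {R : realType}.
Implicit Types m : subprobability (measurableTypeR R) R.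

Lemma subprobability_lt_pinfty m (A : set (measurableTypeR R)) :
  measurable A -> (m A < +oo)%E.
Proof.
move=> mA; apply: le_lt_trans (ltry 1).
by apply: le_trans (@sprobability_setT _ _ _ m); apply: le_measure; rewrite ?inE.
Qed.

Lemma integral_half_line m (f : R -> \bar R) :
  (m `]-oo, 0%R[%classic = 0 -> m.-integrable setT f ->
  \int[m]_x f x = \int[m]_(x in `[0%R, +oo[) f x)%E.
Proof.
move=> m0 fint; rewrite (negligible_integral _ _ fint m0)//.
by congr integral; rewrite setTD setCitvl.
Qed.

Lemma integral_le_cst m (c : R) : 0 <= c ->
  (\int[m]_(x in `[0%R, +oo[) c%:E <= c%:E)%E.
Proof.
move=> c0; rewrite integral_cst//= -[leRHS]mule1 lee_wpmul2l// ?lee_fin//.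
by apply: le_trans (@sprobability_setT _ _ _ m); apply: le_measure; rewrite ?inE.
Qed.

Lemma integrable_bounded d (T : measurableType d)
    (m : {measure set T -> \bar R}) (f : T -> R) (B : R) : (m setT < +oo)%E ->
  measurable_fun setT f -> (forall x, `|f x| <= B) ->
  m.-integrable setT (fun x => (f x)%:E).
Proof.
move=> mfin mf fB; apply: measurable_bounded_integrable => //.
exists B; split; first exact: num_real.
by move=> M BM x _; exact: le_trans (fB _) (ltW BM).
Qed.

Lemma integral_convolution (mu : R -> subprobability (measurableTypeR R) R)
    (s t B : R) (k : R -> R) :
  convolution_semigroup mu -> 0 <= s -> 0 <= t ->
  measurable_fun (`[0, +oo[ : set R) k -> (forall x, 0 <= x -> `|k x| <= B) ->
  (\int[mu (t + s)%R]_(x in `[0%R, +oo[) (k x)%:E =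
   \int[mu t]_(u in `[0%R, +oo[) \int[mu s]_(v in `[0%R, +oo[) (k (u + v)%R)%:E)%E.
Proof.
move=> cs s0 t0 mk kB.
pose K : measurableTypeR R -> R := k \_ `[0, +oo[.
have mK : measurable_fun setT K by apply/(measurable_restrictT _ _).1.
have KB x : `|K x| <= B.
  rewrite /K patchE; case: ifPn => [|_]; first by rewrite inE /= in_itv /= andbT => /kB.
  by rewrite normr0; apply: le_trans (kB 0 _).
have Kk x : 0 <= x -> K x = k x.
  by move=> x0; rewrite /K patchE mem_set//= in_itv/= x0.
have madd : measurable_fun setT (fun p : measurableTypeR R * measurableTypeR R =>
    p.1 + p.2 : measurableTypeR R).
  by apply: measurable_funD; [exact: measurable_fst|exact: measurable_snd].
have mKadd : measurable_fun setT (fun p : measurableTypeR R * measurableTypeR R =>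
    K (p.1 + p.2)).
  exact: measurableT_comp.
have bK m : m.-integrable setT (fun x => (K x)%:E).
  apply: (@integrable_bounded _ _ m K B) => //.
  exact: subprobability_lt_pinfty.
have bKadd : (mu t \x mu s)%E.-integrable setT (fun p => (K (p.1 + p.2)%R)%:E).
  apply: (@integrable_bounded _ _ _ _ B) => //.
  have E : ((mu t \x mu s) setT = mu t setT * mu s setT)%E.
    by rewrite -setXTT product_measure1E.
  rewrite [ltLHS]E ltey_eq fin_numM//.
    by rewrite ge0_fin_numE//; exact: subprobability_lt_pinfty.
  by rewrite ge0_fin_numE//; exact: subprobability_lt_pinfty.
have s_0 := conv_support cs s0; have t_0 := conv_support cs t0.
have ts_0 := conv_support cs (addr_ge0 t0 s0).
transitivity (\int[mu (t + s)%R]_x (K x)%:E)%E.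
  rewrite integral_half_line//; apply: eq_integral => x; rewrite inE /= in_itv /= andbT.
  by move=> /Kk ->.
transitivity (\int[(mu t \x mu s)]_p (K (p.1 + p.2)%R)%:E)%E.
  rewrite -[RHS](@integral_pushforward _ _ _ _ _ _ madd _ setT (fun x => (K x)%:E))//.
    by apply: eq_measure_integral => A mA _; exact/esym/(conv_add cs s0 t0).
  exact/measurable_EFinP.
rewrite -(integral12_prod_meas1 bKadd).
rewrite (integral_half_line t_0 (integrable_fubini_F bKadd)).
apply: eq_integral => u; rewrite inE /= in_itv /= andbT => u0.
rewrite /fubini_F (integral_half_line s_0); last first.
  apply: (@integrable_bounded _ _ _ (fun v : measurableTypeR R => K (u + v)) B) => //.
    exact: subprobability_lt_pinfty.
  by apply: measurableT_comp => //; exact: measurable_funD.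
apply: eq_integral => v; rewrite inE /= in_itv /= andbT => v0.
by rewrite Kk// addr_ge0.
Qed.

End half_line_measure.

(** * Subordinated semigroups *)

Lemma bounded_operator_comp (R : realType) (X Y Z : normedModType R)
    (A : Y -> Z) (B : X -> Y) :
  bounded_operator A -> bounded_operator B -> bounded_operator (A \o B).
Proof.
move=> [M AM] [N BN]; exists (Num.max M 0 * N) => x; rewrite /=.
apply: le_trans (AM _) _; rewrite -mulrA.
apply: le_trans (ler_wpM2l _ (BN x)); last by rewrite le_max lexx orbT.
by rewrite ler_wpM2r// le_max lexx.
Qed.

Section subordination.
Context {R : realType} {X : normedModType R}.
Context {S : R -> {linear X -> X}} {mu : R -> subprobability (measurableTypeR R) R}.
Context {Sphi : R -> X -> X}.
Hypothesis S_semigroup : bounded_C0_semigroup S.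
Hypothesis mu_semigroup : convolution_semigroup mu.
Hypothesis SphiE : forall (t : R) x, 0 <= t ->
  is_Bochner_integral (mu t) `[0, +oo[ (fun s => S s x) (Sphi t x).

Lemma bounded_operator_semigroup t : 0 <= t -> bounded_operator (S t).
Proof. by move=> t0; have [M SM] := C0_bounded S_semigroup; exists M => x; exact: SM. Qed.

Section functional.
Context (eta : {linear X -> R^o}) (eta_bounded : bounded_operator eta).

Lemma functional_orbit_bounded x :
  exists B, forall s, 0 <= s -> `|eta (S s x)| <= B.
Proof.
have [M SM] := C0_bounded S_semigroup; have [N etaN] := eta_bounded.
exists (Num.max N 0 * (M * `|x|)) => s s0; apply: le_trans (etaN _) _.
apply: (@le_trans _ _ (Num.max N 0 * `|S s x|)).
  by rewrite ler_wpM2r// le_max lexx.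
by rewrite ler_wpM2l ?SM// le_max lexx orbT.
Qed.

Lemma functional_orbit_measurable x :
  measurable_fun (`[0, +oo[ : set R) (fun s => eta (S s x) : R).
Proof.
by apply: (measurable_functional_bochner (SphiE x (lexx 0)) eta_bounded).
Qed.

Lemma functional_subordinated t x : 0 <= t ->
  (\int[mu t]_(s in `[0%R, +oo[) (eta (S s x))%:E = (eta (Sphi t x))%:E)%E.
Proof.
move=> t0; apply: (functional_bochner _ (SphiE x t0) eta_bounded) => //.
apply: measurable_bounded_integrable => //.
- exact: subprobability_lt_pinfty.
- exact: functional_orbit_measurable.
have [B etaB] := functional_orbit_bounded x; exists B; split; first exact: num_real.
move=> M BM s; rewrite /= in_itv /= andbT => s0.
exact: le_trans (etaB _ s0) (ltW BM).
Qed.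

End functional.

Lemma subordinated_norm_le (A : {linear X -> X}) (c : R -> R) t x :
  bounded_operator A -> 0 <= t ->
  (forall s, 0 <= s -> `|A (S s x)| <= c s) ->
  ((`|A (Sphi t x)|)%:E <= \int[mu t]_(s in `[0%R, +oo[) (c s)%:E)%E.
Proof.
move=> Ab t0 Ac; have [eta [etaE eta1]] := norming_functional (A (Sphi t x)).
have eta_bounded : bounded_operator eta by exists 1 => y; rewrite mul1r.
pose etaA : {linear X -> R^o} := eta \o A.
have etaA_bounded : bounded_operator etaA by exact: bounded_operator_comp.
rewrite -etaE -(functional_subordinated etaA_bounded)//.
apply: le_trans (lee_abs _) _; apply: le_trans (le_abse_integral _ _ _) _ => //.
  apply/measurable_EFinP; exact: (functional_orbit_measurable etaA_bounded).
apply: ge0_le_lower_integral => s; rewrite /= in_itv /= andbT => s0 //.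
by rewrite lee_fin; apply: le_trans (eta1 _) (Ac _ s0).
Qed.

Lemma subordinatedD s t x : 0 <= s -> 0 <= t -> Sphi (t + s) x = Sphi t (Sphi s x).
Proof.
move=> s0 t0; apply/eqP; rewrite -subr_eq0 -normr_eq0.
have [eta [<- eta1]] := norming_functional (Sphi (t + s) x - Sphi t (Sphi s x)).
have eta_bounded : bounded_operator eta by exists 1 => y; rewrite mul1r.
rewrite linearB subr_eq0 -eqe; apply/eqP.
rewrite -(functional_subordinated eta_bounded _ (addr_ge0 t0 s0)).
have [B etaB] := functional_orbit_bounded eta_bounded x.
rewrite (integral_convolution mu_semigroup s0 t0
  (functional_orbit_measurable eta_bounded x) etaB).
rewrite -(functional_subordinated eta_bounded _ t0).
apply: eq_integral => u; rewrite inE /= in_itv /= andbT => u0.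
pose etaS : {linear X -> R^o} := eta \o S u.
have etaS_bounded : bounded_operator etaS.
  by apply: bounded_operator_comp => //; exact: bounded_operator_semigroup.
rewrite -[RHS](functional_subordinated etaS_bounded _ s0).
apply: eq_integral => v; rewrite inE /= in_itv /= andbT => v0.
by rewrite /etaS /= (C0_add S_semigroup).
Qed.

End subordination.

Section subordination_estimates.
Context {R : realType} {X : normedModType R}.
Context {S : R -> {linear X -> X}} {mu : R -> subprobability (measurableTypeR R) R}.
Context {Sphi : R -> X -> X}.
Hypothesis S_semigroup : bounded_C0_semigroup S.
Hypothesis SphiE : forall (t : R) x, 0 <= t ->
  is_Bochner_integral (mu t) `[0, +oo[ (fun s => S s x) (Sphi t x).

Lemma semigroup_bound_ge1 :
  exists2 M : R, 1 <= M & forall (t : R) x, 0 <= t -> `|S t x| <= M * `|x|.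
Proof.
have [M SM] := C0_bounded S_semigroup; exists (Num.max M 1) => [|t x t0].
  by rewrite le_max lexx orbT.
by apply: le_trans (SM t x t0) _; rewrite ler_wpM2r// le_max lexx.
Qed.

Lemma subordinated_bounded (M t : R) (x : X) : 0 <= M ->
  (forall (t : R) x, 0 <= t -> `|S t x| <= M * `|x|) ->
  0 <= t -> `|Sphi t x| <= M * `|x|.
Proof.
move=> M0 SM t0; rewrite -lee_fin.
apply: le_trans (integral_le_cst (mu t) (mulr_ge0 M0 (normr_ge0 x))).
apply: (subordinated_norm_le S_semigroup SphiE (A := idfun)) => //.
- by exists 1 => y; rewrite mul1r.
- by move=> s s0; exact: SM.
Qed.

(* On [s > T] the dissipation estimate is only available through
   [S s = S T (S (s - T))], which costs the additional term [expR (- g * T)]. *)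
Lemma subordinated_dissipation (P : {linear X -> X}) (T C2 M g t e : R) (x : X) :
  bounded_operator P -> 0 < T -> 0 <= C2 -> 1 <= M -> 0 <= g ->
  (forall (t : R) x, 0 <= t -> `|S t x| <= M * `|x|) ->
  (forall (t : R) x, 0 < t <= T ->
    `|S t x - P (S t x)| <= C2 * expR (- g * t) * `|x|) ->
  0 <= t ->
  (\int[mu t]_(s in `[0%R, +oo[) (expR (- g * s))%:E = e%:E)%E ->
  `|Sphi t x - P (Sphi t x)| <= C2 * M * (e + expR (- g * T)) * `|x|.
Proof.
move=> Pb T0 C20 M1 g0 SM diss t0 he.
have M0 : 0 <= M by apply: le_trans M1.
pose A : {linear X -> X} := idfun \- P.
have Ab : bounded_operator A.
  have [N PN] := Pb; exists (1 + N) => y; rewrite mulrDl mul1r.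
  by apply: le_trans (ler_normB _ _) _; rewrite lerD2l.
have A0 y : `|A y| <= C2 * `|y|.
  have Sy := @C0_strong_continuity _ _ _ S_semigroup y.
  have Scvg : `|A (S s y)| @[s --> 0^'+] --> `|A y|.
    apply: cvg_norm; exact: (continuous_cvg _ (@bounded_operator_cvg _ _ _ A Ab _) Sy).
  apply: (cvgr_to_le Scvg).
  near=> s; apply: le_trans (diss s y _) _.
    apply/andP; split; near: s; [exact: nbhs_right_gt|exact: nbhs_right_le].
  rewrite ler_wpM2r// ler_piMr// -[leRHS](@expR0 R) ler_expR mulNr oppr_le0 mulr_ge0//.
have AS s : 0 <= s -> `|A (S s x)| <= C2 * M * `|x| * (expR (- g * s) + expR (- g * T)).
  rewrite mulrDr => s0; have [sT|Ts] := leP s T.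
    rewrite -[leLHS]addr0 lerD//; last by rewrite !mulr_ge0 ?expR_ge0.
    have [->|s_neq0] := eqVneq s 0.
      rewrite mulr0 expR0 mulr1 (C0_id S_semigroup); apply: le_trans (A0 x) _.
      by rewrite ler_wpM2r// ler_peMr.
    apply: le_trans (diss s x _) _; first by rewrite lt_neqAle eq_sym s_neq0 s0.
    rewrite mulrAC ler_wpM2r ?expR_ge0// ler_wpM2r// ler_peMr//.
  rewrite -[leLHS]add0r lerD//; first by rewrite !mulr_ge0 ?expR_ge0.
  rewrite -(subrKC T s) (C0_add S_semigroup) ?subr_ge0 ?(ltW Ts) ?(ltW T0)//.
  apply: le_trans (diss T _ _) _; first by rewrite T0 lexx.
  rewrite [leRHS]mulrAC -mulrA [leRHS](_ : _ = C2 * expR (- g * T) * (M * `|x|)); last by ring.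
  by rewrite mulrA ler_wpM2l ?mulr_ge0 ?expR_ge0// SM// subr_ge0 ltW.
rewrite -lee_fin; apply: le_trans (subordinated_norm_le S_semigroup SphiE Ab t0 AS) _.
have K0 : 0 <= C2 * M * `|x| by rewrite !mulr_ge0.
under eq_integral do rewrite EFinM EFinD.
have mE : measurable_fun (`[0%R, +oo[ : set (measurableTypeR R))
    (fun s => (expR (- g * s))%:E).
  apply/measurable_EFinP; apply: measurableT_comp => //.
rewrite ge0_integralZl//; last 2 first.
- exact: emeasurable_funD.
- by move=> s _; rewrite -EFinD lee_fin addr_ge0 ?expR_ge0.
rewrite ge0_integralD//; [|by move=> s _; rewrite lee_fin expR_ge0..].
rewrite he [in leRHS]mulrAC [leRHS]EFinM lee_wpmul2l// ?lee_fin ?mulr_ge0//.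
by rewrite EFinD leeD2l// integral_le_cst// expR_ge0.
Unshelve. all: by end_near. Qed.

End subordination_estimates.

Section bernstein.
Context {R : realType} {phi : R -> R} (phi_Bernstein : Bernstein_function phi).

Lemma Bernstein_derive1_ge0 x : 0 < x -> 0 <= phi^`()%classic x.
Proof.
move=> x0; have := Bernstein_sign phi_Bernstein (isT : 1 <= 1)%N x0.
by rewrite mul1r derive1n1.
Qed.

Lemma Bernstein_derive1_nincr x y : 0 < x -> x <= y ->
  phi^`()%classic y <= phi^`()%classic x.
Proof.
move=> x0 xy; rewrite -!derive1n1.
apply: (@ler0_derive1_nincr _ _ x y) => //.
- move=> z; rewrite in_itv/= => /andP[xz _].
  by apply: (Bernstein_smooth phi_Bernstein (k := 1)); exact: lt_trans xz.
- move=> z; rewrite in_itv/= => /andP[xz _].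
  have := Bernstein_sign phi_Bernstein (isT : 1 <= 2)%N (lt_trans x0 xz).
  by rewrite expr1 mulN1r oppr_ge0 derive1nS.
- apply: derivable_within_continuous => z; rewrite in_itv/= => /andP[xz _].
  by apply: (Bernstein_smooth phi_Bernstein (k := 1)); exact: lt_le_trans xz.
Qed.

Lemma Bernstein_le_affine x : 0 < x -> phi x <= phi 1 + phi^`()%classic 1 * x.
Proof.
move=> x0; have d1 := Bernstein_derive1_ge0 ltr01.
have dphi (z : R) : 0 < z -> is_derive z 1 phi (phi^`()%classic z).
  move=> z0; rewrite derive1E; apply: DeriveDef => //.
  exact: (Bernstein_smooth phi_Bernstein (k := 0)).
have cphi (a b : R) : 0 < a -> {within `[a, b], continuous phi}.
  move=> a0; apply: derivable_within_continuous => z; rewrite in_itv/= => /andP[az _].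
  by apply: (Bernstein_smooth phi_Bernstein (k := 0)); exact: lt_le_trans az.
have [x1|x1] := leP x 1.
  have [z|z + E] := MVT_segment x1 (df := phi^`()%classic) _ (cphi x 1 x0).
    by rewrite in_itv/= => /andP[xz _]; apply: dphi; exact: lt_trans xz.
  rewrite in_itv/= => /andP[xz _]; have dz := Bernstein_derive1_ge0 (lt_le_trans x0 xz).
  apply: (@le_trans _ _ (phi 1)); last by rewrite lerDl mulr_ge0// ltW.
  by rewrite -subr_ge0 E mulr_ge0// subr_ge0.
have [z|z + E] := MVT_segment (ltW x1) (df := phi^`()%classic) _ (cphi 1 x ltr01).
  by rewrite in_itv/= => /andP[xz _]; apply: dphi; exact: lt_trans xz.
rewrite in_itv/= => /andP[xz _]; have dz := Bernstein_derive1_nincr ltr01 xz.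
rewrite -lerBlDl E; apply: (@le_trans _ _ (phi^`()%classic 1 * (x - 1))).
  by rewrite ler_wpM2r// subr_ge0 ltW.
by rewrite ler_wpM2l// lerBlDr lerDl ler01.
Qed.

End bernstein.

(** * Observability from an interpolation inequality *)

Section dyadic_sums.
Context {R : realType} {h : R -> R}.
Hypothesis h_ge0 : forall x, 0 < x -> 0 <= h x.
Hypothesis h_nincr : forall x y, 0 < x -> x <= y -> h y <= h x.

Lemma dyadic_sum_le_integral (r : R) n : 0 < r ->
  measurable_fun (`]r, +oo[ : set R) (EFin \o h) ->
  ((\sum_(k < n) r * 2 ^+ k * h (r * 2 ^+ k.+1))%:E <=
   \int[lebesgue_measure]_(x in `]r, (r * 2 ^+ n)%R]) (h x)%:E)%E.
Proof.
move=> r0 mh; have h0 (a : R) : r <= a -> 0 <= h a.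
  by move=> ra; apply: h_ge0; exact: lt_le_trans ra.
have rle m : r <= r * 2 ^+ m by apply: ler_peMr; [exact: ltW|apply: exprn_ege1; rewrite ler1n].
elim: n => [|n IH].
  rewrite big_ord0 integral_ge0// => x; rewrite /= in_itv/= => /andP[rx _].
  by rewrite lee_fin h0// ltW.
rewrite big_ord_recr /= EFinD.
have rn : r * 2 ^+ n <= r * 2 ^+ n.+1.
  by rewrite ler_pM2l// ler_eXn2l// ltr1n.
have -> : (`]r, (r * 2 ^+ n.+1)] =
    `]r, (r * 2 ^+ n)] `|` `](r * 2 ^+ n), (r * 2 ^+ n.+1)])%classic.
  by rewrite -itv_bndbnd_setU// bnd_simp.
have mhS (D : set R) : D `<=` `]r, +oo[ -> measurable_fun D (fun x => (h x)%:E).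
  by move=> rD; exact: (measurable_funS _ rD mh).
rewrite ge0_integral_setU//=.
- apply: leeD => //.
  have -> : (r * 2 ^+ n * h (r * 2 ^+ n.+1))%:E =
    (\int[lebesgue_measure]_(x in `](r * 2 ^+ n)%R, (r * 2 ^+ n.+1)%R])
      (h (r * 2 ^+ n.+1)%R)%:E)%E.
    rewrite integral_cst//= lebesgue_measure_itv/= lte_fin ltr_pM2l// ltr_eXn2l ?ltr1n// ltnSn.
    rewrite -EFinB -EFinM mulrC; congr ((_ * _)%:E).
    by rewrite exprS; ring.
  apply: ge0_le_lower_integral => x; rewrite /= in_itv/= => /andP[rx xr].
    by rewrite lee_fin h0.
  by rewrite lee_fin h_nincr// (le_lt_trans _ rx)// mulr_ge0// ?ltW// exprn_gt0.
- apply: mhS => x; rewrite /= !in_itv/= andbT => -[/andP[] //|/andP[rx _]].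
  exact: le_lt_trans rx.
- move=> x; rewrite /= !in_itv/= => -[/andP[rx _]|/andP[rx _]]; rewrite lee_fin h0// ltW//.
  exact: le_lt_trans rx.
- apply/disj_setPS => x; rewrite /= !in_itv/= => -[/andP[_ xr] /andP[rx _]].
  by move: (le_lt_trans xr rx); rewrite ltxx.
Qed.

Lemma dyadic_sum_small (e L : R) : integrable_at_infinity h -> 0 < e ->
  exists l : R, [/\ 0 < l, L <= l &
    forall n, \sum_(k < n) l * 2 ^+ k * h (l * 2 ^+ k) <= e].
Proof.
move=> [r r0 hint] e0; have mh := measurable_int _ hint.
pose u n := \sum_(k < n) r * 2 ^+ k * h (r * 2 ^+ k.+1).
have r2 k : 0 < r * 2 ^+ k by rewrite mulr_gt0// exprn_gt0.
have u_nd : {homo u : n m / (n <= m)%N >-> n <= m}.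
  apply/nondecreasing_seqP => n; rewrite /u big_ord_recr /= lerDl mulr_ge0 ?h_ge0//.
  exact: ltW.
have u_cvg : cvgn u.
  apply: nondecreasing_is_cvgn => //.
  exists (fine (\int[lebesgue_measure]_(x in `]r, +oo[) (h x)%:E)).
  move=> _ [n _ <-]; rewrite -lee_fin fineK; last exact: integrable_fin_num hint.
  apply: le_trans (dyadic_sum_le_integral n r0 mh) _.
  apply: ge0_subset_integral => //.
  - by move=> x; rewrite /= in_itv/= andbT => rx; rewrite lee_fin h_ge0// (lt_trans r0).
  - by move=> x; rewrite /= !in_itv/= andbT => /andP[].
have [N uN LN] : exists2 N : nat, limn u - u N <= e / 2 & L <= N%:R * r.
  near \oo => N; exists N.
    apply: le_trans (ler_norm _) _; near: N.
    by move/cvgrPdist_le : u_cvg; apply; rewrite divr_gt0.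
  rewrite -ler_pdivrMr//; near: N; exact: nbhs_infty_ger.
exists (r * 2 ^+ N.+1); split => //.
  apply: le_trans LN _; rewrite mulrC ler_pM2l// -natrX ler_nat.
  by apply: leq_trans (leqnSn _) _; exact/ltnW/ltn_expl.
move=> n; have -> : \sum_(k < n) r * 2 ^+ N.+1 * 2 ^+ k * h (r * 2 ^+ N.+1 * 2 ^+ k) =
    2 * (u (N + n)%N - u N).
  rewrite /u big_split_ord /= addrC addrK mulr_sumr; apply: eq_bigr => k _.
  have -> : r * 2 ^+ N.+1 * 2 ^+ k = r * 2 ^+ (N + k).+1 by rewrite -mulrA -exprD.
  by rewrite [X in r * X * h _]exprS; ring.
rewrite mulrC -ler_pdivlMr//; apply: le_trans uN; rewrite lerD2r.
exact: nondecreasing_cvgn_le.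
Unshelve. all: by end_near. Qed.

End dyadic_sums.

Section observability.
Context {R : realType}.

Lemma observability_step (F f : R -> R) (M K G l s t I : R) :
  0 < M -> 0 < K -> 0 < l -> 0 <= G -> s < t -> 0 <= F s -> 0 <= I ->
  (forall tau, s < tau -> tau <= t -> F t <= M * F tau) ->
  (forall tau, s < tau -> tau <= t ->
    F tau <= K * expR l * (f tau + expR (- G * (tau - s)) * F s)) ->
  (forall a c, s <= a -> a <= t -> 0 <= c ->
    (forall tau, a < tau -> tau <= t -> c <= f tau) -> c * (t - a) <= I) ->
  F t <= M * K * expR l * (2 * I / (t - s) + expR (- G * (t - s) / 2) * F s).
Proof.
move=> M0 K0 l0 G0 st Fs0 I0 FM Ff fI.
have N0 : 0 < M * K * expR l by rewrite !mulr_gt0 ?expR_gt0.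
have ts0 : 0 < t - s by rewrite subr_gt0.
rewrite mulrC -ler_pdivrMr// -lerBlDr; set c := (X in X <= _).
have [c0|c0] := leP c 0.
  by apply: le_trans c0 _; rewrite !mulr_ge0// invr_ge0 ltW.
rewrite ler_pdivlMr// -ler_pdivrMl// mulrC -mulrA.
have -> : (t - s) / 2 = t - (s + t) / 2 by field.
apply: fI; [lra|lra|exact: ltW|move=> tau mtau taut].
have stau : s < tau by lra.
rewrite /c lerBlDr ler_pdivrMr// mulrC.
apply: le_trans (FM _ stau taut) _; rewrite -!(mulrA M) ler_pM2l//.
apply: le_trans (Ff _ stau taut) _; apply: ler_wpM2l.
  by rewrite mulr_ge0 ?expR_ge0// ltW.
rewrite lerD2l ler_wpM2r// ler_expR -mulrA !mulNr lerN2 ler_wpM2l//; lra.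
Qed.

Lemma observability_iteration (h : R -> R) (T M K : R) :
  (forall x, 0 < x -> 0 < h x) ->
  (forall x y, 0 < x -> x <= y -> h y <= h x) ->
  integrable_at_infinity h -> 0 < T -> 1 <= M -> 1 <= K ->
  exists2 Cobs : R, 0 < Cobs & forall (F f : R -> R) (B I : R),
    (forall t, 0 <= t -> t <= T -> 0 <= F t <= B) -> 0 <= I ->
    (forall s t, 0 <= s -> s <= t -> t <= T -> F t <= M * F s) ->
    (forall l s t, 0 < l -> 0 <= s -> s < t -> t <= T ->
      F t <= K * expR l * (f t + expR (- (h l)^-1 * (t - s)) * F s)) ->
    (forall a b c, 0 <= a -> a <= b -> b <= T -> 0 <= c ->
      (forall tau, a < tau -> tau <= b -> c <= f tau) -> c * (b - a) <= I) ->
    F T <= Cobs * I.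
Proof.
move=> h0 h_nincr hint T0 M1 K1; set N := M * K.
have M0 : 0 < M by exact: lt_le_trans M1.
have K0 : 0 < K by exact: lt_le_trans K1.
have N0 : 0 < N by rewrite mulr_gt0.
have [||l0 [l0_gt0 Nl0 sum_l0]] := @dyadic_sum_small _ h _ h_nincr (T / 12) (16 * N) hint.
- by move=> x x0; exact/ltW/h0.
- by rewrite divr_gt0.
pose l k : R := l0 * 2 ^+ k.
pose len k : R := 6 * (l k * h (l k)) + T / 4 * 2 ^- k.
pose t k : R := T - \sum_(i < k) len i.
pose w k : R := 2 ^- k * len k * expR (- l k).
have p2 k : 0 < 2 ^+ k :> R by rewrite exprn_gt0.
have l_gt0 k : 0 < l k by rewrite mulr_gt0.
have len_ge k : T / 4 * 2 ^- k <= len k.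
  by rewrite lerDr !mulr_ge0 ?ltW ?h0.
have len_gt0 k : 0 < len k.
  by apply: lt_le_trans (len_ge k); rewrite !mulr_gt0 ?invr_gt0.
have sum2 k : \sum_(i < k) (2 ^- i : R) = 2 - 2 * 2 ^- k.
  elim: k => [|k IH]; first by rewrite big_ord0 expr0 invr1; ring.
  by rewrite big_ord_recr /= IH exprS; field; rewrite gt_eqF.
have t_ge0 k : 0 <= t k.
  rewrite subr_ge0 big_split /= -!mulr_sumr sum2; have := sum_l0 k.
  have : 0 < T / 4 * 2 ^- k by rewrite !mulr_gt0 ?invr_gt0.
  rewrite /l; nra.
have tS k : t k.+1 = t k - len k by rewrite /t big_ord_recr /= opprD addrA.
have t_leT k : t k <= T by rewrite lerBlDr lerDl sumr_ge0// => i _; exact: ltW.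
have len_leT k : len k <= T by have := t_ge0 k.+1; have := t_leT k; rewrite tS; lra.
have w_gt0 k : 0 < w k by rewrite !mulr_gt0 ?invr_gt0 ?expR_gt0.
exists (4 * N / w 0%N); first by rewrite divr_gt0// mulr_gt0.
move=> F f B I FB I0 FM Ff fI.
have F0 k : 0 <= F (t k) by have /andP[] := FB _ (t_ge0 k) (t_leT k).
have wS k : 2 ^- k * len k * N * expR (- (h (l k))^-1 * len k / 2) <= w k.+1.
  have lS : l k.+1 = 2 * l k by rewrite /l exprS; ring.
  have hlk := h0 _ (l_gt0 k).
  have E1 : expR (- (h (l k))^-1 * len k / 2) <= expR (- l k.+1) * expR (- l k).
    rewrite -expRD ler_expR lS.
    have : (h (l k))^-1 * (6 * (l k * h (l k))) <= (h (l k))^-1 * len k.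
      by rewrite ler_pM2l ?invr_gt0// lerDl !mulr_ge0 ?invr_ge0// ltW.
    have -> : (h (l k))^-1 * (6 * (l k * h (l k))) = 6 * l k by field; rewrite gt_eqF.
    lra.
  have E2 : N * expR (- l k) <= 2 ^- k / 16.
    have lk : 16 * N * 2 ^+ k <= expR (l k).
      apply: le_trans (ltW (expR_gt1Dx _)); rewrite ?gt_eqF// -[leLHS]add0r lerD//.
      by rewrite ler_wpM2r// ltW.
    rewrite expRN ler_pdivrMr ?expR_gt0//.
    rewrite [leLHS](_ : N = 2 ^- k / 16 * (16 * N * 2 ^+ k)); last by field; rewrite gt_eqF.
    by rewrite ler_wpM2l// divr_ge0// invr_ge0 ltW.
  have e1 := expR_gt0 (- l k.+1); have i2 : 0 < 2 ^- k :> R by rewrite invr_gt0.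
  apply: (@le_trans _ _ (2 ^- k * len k * N * (expR (- l k.+1) * expR (- l k)))).
    by rewrite ler_wpM2l// !mulr_ge0// ltW.
  rewrite /w [leLHS](_ : _ = 2 ^- k * (len k * (N * expR (- l k))) * expR (- l k.+1));
    last by ring.
  rewrite ler_pM2r//.
  rewrite [leRHS](_ : _ = 2 ^- k * (len k.+1 / 2)).
    rewrite ler_pM2l//.
    apply: (@le_trans _ _ (T * (2 ^- k / 16))).
      by apply: ler_pM => //; rewrite ?mulr_ge0 ?expR_ge0// ltW.
    by have := len_ge k.+1; rewrite exprS invfM; lra.
  by rewrite exprS; field; rewrite gt_eqF.
have step k : w k * F (t k) <= 2 ^- k * (2 * N * I) + w k.+1 * F (t k.+1).
  have st : t k.+1 < t k by rewrite tS gtrBl.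
  have T_tau tau : t k.+1 < tau -> tau <= t k -> 0 <= tau /\ tau <= T.
    move=> /ltW s_tau tau_t; split; first exact: le_trans (t_ge0 _) s_tau.
    exact: le_trans tau_t (t_leT _).
  have Fstep : F (t k) <= M * K * expR (l k) * (2 * I / (t k - t k.+1) +
      expR (- (h (l k))^-1 * (t k - t k.+1) / 2) * F (t k.+1)).
    apply: (@observability_step F f) => //.
    - by rewrite invr_ge0 ltW// h0.
    - by move=> tau s_tau tau_t; have [? ?] := T_tau tau s_tau tau_t; exact: FM.
    - by move=> tau s_tau tau_t; have [? ?] := T_tau tau s_tau tau_t; exact: Ff.
    - by move=> a c sa at_ c0 cf; apply: fI => //; exact: le_trans (t_ge0 _) sa.
  have {Fstep} := ler_wpM2l (ltW (w_gt0 k)) Fstep; move/le_trans; apply.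
  have -> : t k - t k.+1 = len k by rewrite tS; ring.
  have := ler_wpM2r (F0 k.+1) (wS k); move: (expR (- (h (l k))^-1 * _ / 2)) => E wSF.
  rewrite [leLHS](_ : _ = 2 ^- k * (2 * N * I) + 2 ^- k * len k * N * E * F (t k.+1)).
    by rewrite lerD2l.
  rewrite /w /N expRN; field; rewrite !gt_eqF//; exact: expR_gt0.
have iter n : w 0%N * F T <= (\sum_(k < n) 2 ^- k) * (2 * N * I) + w n * F (t n).
  elim: n => [|n IH]; first by rewrite big_ord0 mul0r add0r /t big_ord0 subr0.
  apply: le_trans IH _; rewrite big_ord_recr /= [X in _ <= X + _]mulrDl -addrA lerD2l.
  exact: step.
have w_le n : w n * F (t n) <= 2 ^- n * (T * B).
  have /andP[_ FtB] := FB _ (t_ge0 n) (t_leT n).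
  rewrite /w -!mulrA; apply: ler_wpM2l; first by rewrite invr_ge0 ltW.
  apply: ler_pM => //; first exact: ltW.
    by rewrite mulr_ge0// expR_ge0.
  apply: le_trans FtB; rewrite ler_piMl// -[leRHS]expR0 ler_expR oppr_le0; exact: ltW.
rewrite mulrAC ler_pdivlMr// mulrC; apply/ler_addgt0Pl => e e0.
have TB0 : 0 <= T * B.
  apply: mulr_ge0; first exact: ltW.
  by have /andP[F_ge0 F_le] := FB T (ltW T0) (lexx T); exact: le_trans F_le.
have [n nTB] : exists n : nat, T * B / e <= n%:R.
  by exists (Num.bound (T * B / e)); apply/ltW/archi_boundP; rewrite divr_ge0// ltW.
apply: le_trans (iter n) _; rewrite addrC lerD//.
  apply: le_trans (w_le n) _; rewrite mulrC ler_pdivrMr// -ler_pdivrMl// mulrC.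
  apply: le_trans nTB _; rewrite -natrX ler_nat; exact/ltnW/ltn_expl.
rewrite sum2; have : 0 <= 2 ^- n * (N * I) by rewrite !mulr_ge0 ?invr_ge0// ltW.
lra.
Qed.

End observability.

Lemma cst_le_integral_itv (R : realType) (f : R -> R) (T a b c : R) :
  0 <= a -> a <= b -> b <= T -> 0 <= c -> (forall x, 0 <= f x) ->
  (forall x, a < x -> x <= b -> c <= f x) ->
  ((c * (b - a))%:E <= \int[lebesgue_measure]_(x in `[0%R, T]) (f x)%:E)%E.
Proof.
move=> a0 ab bT c0 f0 cf.
have -> : (c * (b - a))%:E = (\int[lebesgue_measure]_(x in `]a, b]) c%:E)%E.
  rewrite integral_cst//= lebesgue_measure_itv/= lte_fin.
  have [_|ba] := ltP a b; first by rewrite -EFinB -EFinM.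
  by rewrite (@le_anti _ _ a b) ?ab// subrr mulr0 mule0.
have -> : `]a, b]%classic = `[0, T] `&` `]a, b] :> set R.
  apply/esym/setIidr => x; rewrite /= !in_itv/= => /andP[ax xb].
  by rewrite (le_trans a0 (ltW ax)) (le_trans xb).
rewrite integral_mkcondr; apply: ge0_le_lower_integral => x _; rewrite patchE.
  by case: ifP => // _; rewrite lee_fin.
case: ifPn; rewrite ?lee_fin// inE /= in_itv/= => /andP[ax xb].
exact: cf.
Qed.

Lemma uncertainty_interpolation (R : realType) (X Y : normedModType R)
    (C : {linear X -> Y}) (c C1 el D : R) (z v : X) :
  0 <= C1 -> 0 <= c -> 1 <= el -> (forall x, `|C x| <= c * `|x|) ->
  `|v| <= C1 * el * `|C v| -> `|z - v| <= D ->
  `|z| <= (C1 + (C1 * c + 1) + 1) * el * (`|C z| + D).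
Proof.
move=> C10 c0 el1 Cc vC zv.
have el0 : 0 <= el by apply: le_trans el1.
have D0 : 0 <= D by exact: le_trans zv.
have Cv : `|C v| <= `|C z| + c * D.
  rewrite -[v](subKr z) linearB; apply: le_trans (ler_normB _ _) _.
  by rewrite lerD2l; apply: le_trans (Cc _) _; rewrite ler_wpM2l.
have zD : `|z| <= `|v| + D.
  by rewrite -[z in leLHS](subrK v) addrC (le_trans (ler_normD _ _))// lerD2l.
have : `|v| <= C1 * el * (`|C z| + c * D).
  by apply: le_trans vC _; rewrite ler_wpM2l// mulr_ge0.
have : D <= el * D by rewrite ler_peMl.
have : 0 <= C1 * el * D by rewrite !mulr_ge0.
have : 0 <= C1 * c * el * `|C z| by rewrite !mulr_ge0.
have : 0 <= el * `|C z| by rewrite !mulr_ge0.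
have : 0 <= el * D by rewrite !mulr_ge0.
move: zD; move: (`|C z|) (`|v|) (`|z|) => p q r; lra.
Qed.

Theorem theorem3p8 (R : realType) (X Y : completeNormedModType R)
    (C : {linear X -> Y}) (P : R -> {linear X -> X})
    (S : R -> {linear X -> X}) (T : R) (g : R -> R) (C1 C2 : R)
    (phi : R -> R) (Sphi : R -> X -> X)
    (C_bounded : bounded_operator C)
    (P_bounded : forall l : R, 0 < l -> bounded_operator (P l))
    (S_semigroup : bounded_C0_semigroup S)
    (T_gt0 : 0 < T)
    (g_gt0 : forall l : R, 0 < l -> 0 < g l)
    (g_measurable : measurable_fun (`]0, +oo[ : set R) g)
    (C1_ge0 : 0 <= C1) (C2_ge1 : 1 <= C2)
    (uncertainty : forall (l : R) (x : X), 0 < l ->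
      `|P l x| <= C1 * expR l * `|C (P l x)|)
    (dissipation : forall (l t : R) (x : X), 0 < l -> 0 < t <= T ->
      `|S t x - P l (S t x)| <= C2 * expR (- g l * t) * `|x|)
    (phi_Bernstein : Bernstein_function phi)
    (Sphi_subordinated : subordinated_semigroup phi S Sphi)
    (phi_g_neq0 : forall l : R, 0 < l -> phi (g l) != 0)
    (ratio_decreasing : forall l1 l2 : R, 0 < l1 -> l1 <= l2 ->
      l2 / phi (g l2) <= l1 / phi (g l1))
    (inv_integrable : integrable_at_infinity (fun l => (phi (g l))^-1)) :
  exists2 Cobs : R, 0 <= Cobs &
    forall x : X,
      ((`|Sphi T x|)%:E <=
        Cobs%:E * \int[lebesgue_measure]_(tau in `[0%R, T]) (`|C (Sphi tau x)|)%:E)%E.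
Proof.
have [mu [[mu_semigroup mu_laplace] SphiE]] := Sphi_subordinated.
have [M M1 SM] := semigroup_bound_ge1 S_semigroup.
have M0 : 0 <= M by apply: le_trans M1.
have [c0 CC0] := C_bounded; pose c := Num.max c0 0.
have c_ge0 : 0 <= c by rewrite le_max lexx orbT.
have Cc x : `|C x| <= c * `|x|.
  by apply: le_trans (CC0 x) _; rewrite ler_wpM2r// le_max lexx.
have G_gt0 l : 0 < l -> 0 < phi (g l).
  by move=> l0; rewrite lt_neqAle eq_sym phi_g_neq0// (Bernstein_ge0 phi_Bernstein)// g_gt0.
pose h l := (phi (g l))^-1.
have h_gt0 l : 0 < l -> 0 < h l by move=> l0; rewrite invr_gt0 G_gt0.
have h_nincr x y : 0 < x -> x <= y -> h y <= h x.
  move=> x0 xy; have y0 : 0 < y by exact: lt_le_trans xy.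
  rewrite -(ler_pM2l y0); apply: le_trans (ratio_decreasing _ _ x0 xy) _.
  by rewrite ler_wpM2r// ltW// h_gt0.
pose a := phi 1; pose b := phi^`()%classic 1 + 1.
have a_ge0 : 0 <= a by exact: (Bernstein_ge0 phi_Bernstein).
have b_gt0 : 0 < b by rewrite ltr_wpDl// (Bernstein_derive1_ge0 phi_Bernstein).
pose T' := Num.min T (T / b).
have T'_gt0 : 0 < T' by rewrite lt_min T_gt0 divr_gt0.
have T'T : T' <= T by rewrite ge_min lexx.
pose D := C2 * M * (1 + expR (T' * a)).
have C2_ge0 : 0 <= C2 by apply: le_trans C2_ge1.
have D_ge0 : 0 <= D by rewrite !mulr_ge0// addr_ge0// expR_ge0.
have dissipation' l t x : 0 < l -> 0 <= t -> t <= T' ->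
    `|Sphi t x - P l (Sphi t x)| <= D * expR (- phi (g l) * t) * `|x|.
  move=> l0 t0 tT'; have gl0 := g_gt0 _ l0.
  apply: le_trans (subordinated_dissipation S_semigroup SphiE x (P_bounded _ l0) T_gt0
    C2_ge0 M1 (ltW gl0) SM (fun t x => dissipation l t x l0) t0 (mu_laplace t (g l) t0 gl0)) _.
  rewrite ler_wpM2r// /D -(mulrA (C2 * M)) ler_wpM2l ?mulr_ge0//.
  have -> : - phi (g l) * t = - t * phi (g l) by ring.
  rewrite mulrDl mul1r -expRD lerD2l ler_expR.
  have tb : t * b <= T.
    by rewrite -ler_pdivlMr//; apply: le_trans tT' _; rewrite ge_min lexx orbT.
  have phil := ler_wpM2l t0 (Bernstein_le_affine phi_Bernstein gl0).
  have ta : t * a <= T' * a by rewrite ler_wpM2r.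
  have tbg : t * b * g l <= T * g l by rewrite ler_pM2r.
  have tg : 0 <= t * g l by rewrite mulr_ge0// ltW.
  rewrite /b /a in tbg ta *; lra.
pose K := (C1 + (C1 * c + 1) + 1) * (D + 1).
have K_ge1 : 1 <= K.
  have K1 : 0 <= C1 + C1 * c by rewrite addr_ge0// mulr_ge0.
  by rewrite /K; nra.
have [Cobs Cobs_gt0 obs] :=
  observability_iteration h_gt0 h_nincr inv_integrable T'_gt0 M1 K_ge1.
exists (M * Cobs); first by rewrite mulr_ge0// ltW.
move=> x; set J := (\int[_]_(tau in _) _)%E.
have J0 : (0 <= J)%E by apply: integral_ge0 => tau _; rewrite lee_fin.
have [->|Jlt] := eqVneq J +oo%E.
  by rewrite gt0_muley ?leey// lte_fin mulr_gt0// (lt_le_trans ltr01).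
have Jfin : J \is a fin_num by rewrite ge0_fin_numE// ltey.
have Sphi_decay s t : 0 <= s -> s <= t -> `|Sphi t x| <= M * `|Sphi s x|.
  move=> s0 st; rewrite -(subrK s t) (subordinatedD S_semigroup mu_semigroup SphiE) ?subr_ge0//.
  by apply: (subordinated_bounded S_semigroup SphiE) => //; rewrite subr_ge0.
rewrite -(fineK Jfin) -EFinM lee_fin.
apply: le_trans (Sphi_decay T' T (ltW T'_gt0) T'T) _; rewrite -mulrA ler_wpM2l//.
apply: (obs (fun t => `|Sphi t x|) (fun t => `|C (Sphi t x)|) (M * `|x|)).
- move=> t t0 tT'; rewrite normr_ge0/=.
  exact: (subordinated_bounded S_semigroup SphiE).
- exact: fine_ge0.
- by move=> s t s0 st _; exact: Sphi_decay.
- move=> l s t l0 s0 st tT'; rewrite /h invrK.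
  have ts0 : 0 <= t - s by rewrite subr_ge0 ltW.
  have t0 : 0 <= t by exact: le_trans (ltW st).
  have tsT' : t - s <= T' by rewrite lerBlDr (le_trans tT')// lerDl.
  have := dissipation' l (t - s) (Sphi s x) l0 ts0 tsT'.
  rewrite -(subordinatedD S_semigroup mu_semigroup SphiE)// subrK => zvD.
  have el1 : 1 <= expR l by rewrite -[leLHS]expR0 ler_expR ltW.
  apply: le_trans (uncertainty_interpolation C1_ge0 c_ge0 el1 Cc (uncertainty l _ l0) zvD) _.
  have := mulr_ge0 (expR_ge0 (- phi (g l) * (t - s))) (normr_ge0 (Sphi s x)).
  rewrite -[D * _ * _]mulrA; have := normr_ge0 (C (Sphi t x)).
  move: (`|C _|) (expR (- _ * _) * _) => p q p0 q0.
  rewrite /K (_ : _ * (D + 1) * expR l * (p + q) =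
    (C1 + (C1 * c + 1) + 1) * expR l * ((D + 1) * (p + q))); last by ring.
  rewrite ler_wpM2l ?mulr_ge0 ?expR_ge0 ?addr_ge0 ?mulr_ge0//.
  have := mulr_ge0 D_ge0 p0; lra.
- move=> a' b' c' a0 ab bT' c0' cf; rewrite -lee_fin (fineK Jfin).
  by apply: cst_le_integral_itv => //; exact: le_trans T'T.
Qed.
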